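(* Let $r\ge 2$ be an integer and let $s,s_3,\dots,s_r,t_3,\dots,t_r$ be positive integers with $t_i\ge s_i$ for all $i\in\{3,\dots,r\}$. Then, as $n\to\infty$ (with all the other parameters fixed), $$\hat r(K_{s,n},K_{s,n},K_{s_3,t_3},\dots,K_{s_r,t_r})=n\cdot\min\{a\cdot f(a): a\in\mathbb N,\ a>\sigma\}+O(1),$$ where $\sigma=2s-r+\sum_{i=3}^r s_i$ and $$f(a)=\frac{2\binom as}{\binom{\lfloor a'/2\rfloor}s+\binom{\lceil a'/2\rceil}s},\qquad a'=a-\sum_{i=3}^r(s_i-1).$$
   Context: All graphs are finite and simple; $K_{m,n}$ is the complete bipartite graph with parts of sizes $m$ and $n$. For graphs $G,H_1,\dots,H_r$ write $G\to(H_1,\dots,H_r)$ if for every colouring $E(G)\to\{1,\dots,r\}$ there is $i$ such that the graph formed by the edges of colour $i$ contains a copy of $H_i$ as a (not necessarily induced) subgraph. The size Ramsey number is $\hat r(H_1,\dots,H_r)=\min\{e(G): G\to(H_1,\dots,H_r)\}$, where $e(G)$ is the number of edges of $G$. (For $r=2$ the list of forbidden graphs is just $K_{s,n},K_{s,n}$, and the sums over $i$ are empty.) *)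

(* Defs.v *)
From mathcomp Require Import boolp classical_sets.
From mathcomp Require Import all_boot all_order all_algebra.

Set Implicit Arguments.
Unset Strict Implicit.
Unset Printing Implicit Defensive.

Record sgraph := SGraph {
  vertex :> finType;
  adj : rel vertex;
  adj_sym : symmetric adj;
  adj_irrefl : irreflexive adj
}.

Definition edges (G : sgraph) : {set {set G}} :=
  [set [set p.1; p.2] | p in [pred p : G * G | adj p.1 p.2]].

Definition contains_copy (G H : sgraph) : Prop :=
  exists2 h : H -> G, injective h & forall x y, adj x y -> adj (h x) (h y).

Section CompleteBipartite.
Variables m n : nat.

Definition Kadj : rel ('I_m + 'I_n) := fun u v =>
  match u, v with inl _, inr _ | inr _, inl _ => true | _, _ => false end.

Lemma Kadj_sym : symmetric Kadj.
Proof. by case=> ? [] ?. Qed.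

Lemma Kadj_irrefl : irreflexive Kadj.
Proof. by case. Qed.

Definition K : sgraph := SGraph Kadj_sym Kadj_irrefl.
End CompleteBipartite.

Section ColourClass.
Variables (G : sgraph) (c : {set G} -> nat) (i : nat).

Definition class_adj : rel G := fun x y => adj x y && (c [set x; y] == i).

Lemma class_adj_sym : symmetric class_adj.
Proof. by move=> x y; rewrite /class_adj adj_sym setUC. Qed.

Lemma class_adj_irrefl : irreflexive class_adj.
Proof. by move=> x; rewrite /class_adj adj_irrefl. Qed.

Definition colour_class : sgraph := SGraph class_adj_sym class_adj_irrefl.
End ColourClass.

(* Colours are the integers 1, ..., r; c is constrained on the edges only. *)
Definition arrows (G : sgraph) (r : nat) (H : nat -> sgraph) : Prop :=
  forall c : {set G} -> nat,
    (forall e, e \in edges G -> 1 <= c e <= r) ->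
    exists2 i, 1 <= i <= r & contains_copy (colour_class c i) (H i).

Definition is_minimum (d : Order.disp_t) (T : porderType d)
    (P : T -> Prop) (m : T) : Prop :=
  P m /\ forall x, P x -> (m <= x)%O.

(* For 1 <= r the minimum exists by Ramsey's theorem, so the default value 0 of
   xget is then never used. *)
Definition size_ramsey (r : nat) (H : nat -> sgraph) : nat :=
  xget 0 (is_minimum (fun e : nat =>
    exists2 G : sgraph, arrows G r H & e = #|edges G|)).

Definition forbidden (s n : nat) (si ti : nat -> nat) (i : nat) : sgraph :=
  if i <= 2 then K s n else K (si i) (ti i).

Section Weights.
Variables (r s : nat) (si : nat -> nat).

(* None of the truncated subtractions below truncates when 2 <= r, s > 0,
   si i > 0 for 3 <= i <= r, and a > sigma. *)
Definition sigma : nat := 2 * s + \sum_(3 <= i < r.+1) si i - r.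

Definition a' (a : nat) : nat := a - \sum_(3 <= i < r.+1) (si i - 1).

Definition f (a : nat) : rat :=
  (2 * 'C(a, s)%:R / ('C((a' a)./2, s)%:R + 'C(uphalf (a' a), s)%:R))%R.
End Weights.

(* Main.v *)
(** Upper bound: let [a] be the minimiser and host the complete bipartite graph
    with parts of sizes [a] and [N = n f(a) + O(1)].  All but boundedly many of
    the [N] vertices have fewer than [s_i] edges of each colour [i >= 3], hence
    at least [a'] edges of colours 1 and 2; by convexity such a vertex is joined
    in colour 1 or 2 to at least [C(floor(a'/2), s) + C(ceil(a'/2), s)]
    [s]-sets, and some [s]-set gets [n] common neighbours by pigeonhole.

    Lower bound: in a graph with at most [m n] edges the set [A] of vertices of
    degree at least [n] is bounded, and it contains the [s]-side of every
    [K_{s,n}].  Give colour 1 to the edges inside [A] and outside [A]; at a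
    vertex [v] outside [A], use each colour [i >= 3] fewer than [s_i] times, which
    excludes [K_{s_i,t_i}] since [s_i <= t_i], and split the other edges to [A]
    evenly between colours 1 and 2.  If all such patterns are equally
    distributed over the vertices with a given trace [T] on [A], then, up to
    [O(1)], an [s]-set inside [T] is monochromatic in a given colour for a
    fraction [1 / f(|T|) <= |T| / m] of them (for none if [|T| <= sigma]).
    Summing over [T], an [s]-set has at most [e(G) / m + O(1)] common neighbours
    in either colour. *)

From mathcomp Require Import boolp classical_sets.
From mathcomp Require Import all_boot all_order all_algebra.
From mathcomp Require Import perm zify ring.
Require Import Defs.

Set Implicit Arguments.
Unset Strict Implicit.
Unset Printing Implicit Defensive.

Import Order.TTheory GRing.Theory Num.Theory.

(** * Convexity of binomial coefficients and colourings with capacities *)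

(** Discrete convexity: by Pascal's rule the increments of ['C(_, s.+1)] are values of ['C(_, s)],
    which is nondecreasing. *)
Lemma bin_exchange s k x y : x <= y ->
  'C(x + k, s) + 'C(y, s) <= 'C(x, s) + 'C(y + k, s).
Proof.
case: s => [|s] xy; first by rewrite !bin0.
elim: k => [|k IHk]; first by rewrite !addn0.
rewrite !addnS !binS.
have : 'C(x + k, s) <= 'C(y + k, s) by rewrite leq_bin2l ?leq_add2r.
by lia.
Qed.

Lemma bin_balanced D s x y : D <= x + y ->
  'C(D./2, s) + 'C(uphalf D, s) <= 'C(x, s) + 'C(y, s).
Proof.
wlog xy : x y / x <= y => [wl|Dxy].
  case/orP: (leq_total x y) => /wl // H Dxy.
  by rewrite [X in _ <= X]addnC; apply: H; rewrite addnC.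
have Dsum : D = D./2 + uphalf D by lia.
case: (leqP D./2 x) => hx.
  by apply: leq_add; apply: leq_bin2l; lia.
(* Here [x] lies below [D./2]: shifting [D./2 - x] units from the smaller half to the larger cannot
   decrease the sum, and the larger part is then at most [y]. *)
have := bin_exchange s (D./2 - x) (_ : x <= uphalf D).
rewrite subnKC ?(ltnW hx) // => H.
apply: leq_trans (H _) _; first by lia.
by rewrite leq_add2l; apply: leq_bin2l; lia.
Qed.

Lemma sum_card_fibres (T I : finType) (A : {set T}) (phi : T -> I) :
  \sum_i #|[set x in A | phi x == i]| = #|A|.
Proof.
rewrite -sum1_card (partition_big phi predT) //=.
by apply: eq_bigr => i _; rewrite -sum1_card; apply: eq_bigl => x; rewrite inE.
Qed.

(** Greedy: colour all of [A] but one point; the capacities add up to more than the points coloured,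
    so some class has room for the last one. *)
Lemma exists_capped_colouring (T I : finType) (i0 : I) (A : {set T})
    (k : I -> nat) : #|A| <= \sum_i k i ->
  exists phi : {ffun T -> I}, forall i, #|[set x in A | phi x == i]| <= k i.
Proof.
elim: {A}_.+1 {-2}A (ltnSn #|A|) => // m IHm A Am Ak.
case: (set_0Vmem A) => [->|[x xA]].
  exists [ffun=> i0] => i.
  by rewrite (_ : [set _ in _ | _] = set0) ?cards0 //; apply/setP => z; rewrite !inE.
have Ax : #|A| = #|A :\ x|.+1 by rewrite (cardsD1 x) xA.
have [||phi Hphi] := IHm (A :\ x); try by lia.
have [i Hi] : exists i, #|[set y in A :\ x | phi y == i]| < k i.
  apply/existsP; apply: contraTT Ak; rewrite negb_exists -ltnNge => /forallP H.
  rewrite Ax ltnS -(sum_card_fibres (A :\ x) phi).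
  by apply: leq_sum => i _; rewrite leqNgt H.
exists [ffun z => if z == x then i else phi z] => j.
have [<-|ij] := eqVneq i j.
  apply: leq_trans Hi; rewrite -add1n -(cards1 x).
  apply: leq_trans (leq_card_setU _ _); apply: subset_leq_card.
  by apply/subsetP => z; rewrite !inE ffunE; case: (z == x); case: (z \in A).
apply: leq_trans (Hphi j); apply: subset_leq_card.
apply/subsetP => z; rewrite !inE ffunE.
case: (z == x) => [/andP[_ /eqP E]|/andP[-> ->] //].
by rewrite E eqxx in ij.
Qed.

(** * Symmetric families of colourings *)

Section SymmetricFamilies.
Variables (V I : finType) (T : {set V}) (Om : {set {ffun V -> I}}).
Hypothesis OmT : forall x y phi, x \in T -> y \in T -> phi \in Om ->
  [ffun z => phi (tperm x y z)] \in Om.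
Implicit Type X Y : {set V}.

Definition mono_on X i := [set phi in Om | X \subset [set x | phi x == i]].

(** Induction on [#|X :\: Y|]: for [x] in [X] only and [y] in [Y] only, composing with the
    transposition of [x] and [y] is injective and replaces [X] by a set nearer to [Y]. *)
Lemma leq_card_mono_on i X Y : X \subset T -> Y \subset T -> #|X| = #|Y| ->
  #|mono_on X i| <= #|mono_on Y i|.
Proof.
elim: {X}_.+1 {-2}X (ltnSn #|X :\: Y|) => // m IHm X Xm XT YT XY.
case: (set_0Vmem (X :\: Y)) => [/eqP|[x]].
  rewrite setD_eq0 => sXY; suff -> : X = Y by [].
  by apply/eqP; rewrite eqEcard sXY XY leqnn.
rewrite inE => /andP[xY xX].
have [y /andP[yY yX]] : exists y, (y \in Y) && (y \notin X).
  apply/existsP; apply: contraNT xY; rewrite negb_exists => /forallP H.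
  suff -> : Y = X by [].
  apply/eqP; rewrite eqEcard XY leqnn andbT; apply/subsetP => z zY.
  by have := H z; rewrite zY negbK.
have xT := subsetP XT _ xX; have yT := subsetP YT _ yY.
have xy : x != y by apply: contraNneq xY => ->.
pose X1 := y |: X :\ x.
have cX1 : #|X1| = #|X|.
  by rewrite cardsU1 !inE (negPf yX) andbF /= (cardsD1 x X) xX.
apply: (@leq_trans #|mono_on X1 i|); last first.
  apply: IHm => //; last by rewrite cX1.
    rewrite -ltnS; apply: leq_trans Xm.
    rewrite ltnS [X in _ < X](cardsD1 x) inE xX xY /= add1n ltnS.
    apply: subset_leq_card; apply/subsetP => z; rewrite !inE.
    by case: eqVneq => [->|_] /=; [rewrite yY|case: (z \in Y); case: (z == x)].
  apply/subsetP => z; rewrite !inE => /orP[/eqP->//|/andP[_ zX]].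
  exact: (subsetP XT).
pose g (phi : {ffun V -> I}) := [ffun z => phi (tperm x y z)] : {ffun V -> I}.
have gK : involutive g by move=> phi; apply/ffunP => z; rewrite !ffunE tpermK.
rewrite -(card_imset _ (inv_inj gK)); apply: subset_leq_card.
apply/subsetP => _ /imsetP[phi + ->]; rewrite !inE => /andP[pO /subsetP pX].
rewrite OmT //=; apply/subsetP => z; rewrite !inE ffunE.
case/orP => [/eqP->|/andP[zx zX]].
  by rewrite tpermR; have := pX x xX; rewrite inE.
rewrite tpermD; first by have := pX z zX; rewrite inE.
  by rewrite eq_sym.
by apply: contraNneq yX => ->.
Qed.

(** Double counting of pairs of a colouring and a set [Y] of size [#|X|] inside its class [i] in
    [T]; by symmetry every [Y] occurs equally often. *)
Lemma card_mono_on i X : X \subset T ->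
  #|mono_on X i| * 'C(#|T|, #|X|)
  = \sum_(phi in Om) 'C(#|[set x in T | phi x == i]|, #|X|).
Proof.
move=> XT.
transitivity (\sum_(Y : {set V} | (Y \subset T) && (#|Y| == #|X|)) #|mono_on Y i|).
  rewrite mulnC -cards_draws -sum_nat_const.
  apply: eq_big => Y; first by rewrite inE.
  by rewrite inE => /andP[YT /eqP YX]; apply/eqP; rewrite eqn_leq !leq_card_mono_on.
transitivity (\sum_(Y : {set V} | (Y \subset T) && (#|Y| == #|X|))
                \sum_(phi in mono_on Y i) 1).
  by apply: eq_bigr => Y _; rewrite sum1_card.
rewrite (exchange_big_dep (mem Om)) /=; last by move=> Y phi _; rewrite inE => /andP[].
apply: eq_bigr => phi pO; rewrite sum1_card -cards_draws.
apply: eq_card => Y; rewrite !inE [in LHS]unfold_in /= !inE.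
rewrite pO /= andbAC; congr (_ && _).
apply/andP/subsetP => [[/subsetP YT /subsetP Yi] y yY|H].
  by rewrite inE YT //=; have := Yi y yY; rewrite inE.
by split; apply/subsetP => y /H; rewrite !inE => /andP[].
Qed.
End SymmetricFamilies.

(** * Upper bound: colourings of a complete bipartite host *)

Lemma sum_bin_card (U V : finType) (N : V -> {set U}) p :
  \sum_v 'C(#|N v|, p)
  = \sum_(X : {set U} | #|X| == p) #|[set v | X \subset N v]|.
Proof.
under [RHS]eq_bigr do rewrite -sum1dep_card.
rewrite (exchange_big_dep predT) //=; apply: eq_bigr => v _.
rewrite -cards_draws -sum1_card; apply: eq_bigl => X.
by rewrite inE andbC.
Qed.

(** The denominator of [f]: by [bin_balanced], the least total number of [s]-subsets of two sets
    whose sizes add up to at least [a']. *)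
Definition weight (r s : nat) (si : nat -> nat) (a : nat) : nat :=
  'C((a' r si a)./2, s) + 'C(uphalf (a' r si a), s).

Lemma mem_edges (G : sgraph) (x y : G) : adj x y -> [set x; y] \in edges G.
Proof. by move=> xy; apply/imsetP; exists (x, y). Qed.

Section CompleteBipartiteHost.
Variables (a N : nat) (c : {set K a N} -> nat).
Implicit Types (u : 'I_a) (v : 'I_N).

Definition colour_nbhd i v := [set u | c [set inl u; inr v] == i].

Lemma contains_copy_common_nbhd i p q (X : {set 'I_a}) : #|X| = p ->
  q <= #|[set v | X \subset colour_nbhd i v]| ->
  contains_copy (colour_class c i) (K p q).
Proof.
move=> Xp Yq; set Y := [set _ | _] in Yq.
pose h (x : K p q) : K a N := match x with
  | inl k => inl (enum_val (cast_ord (esym Xp) k))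
  | inr l => inr (enum_val (widen_ord Yq l)) end.
have hc k l : c [set inl (enum_val (cast_ord (esym Xp) k));
                     inr (enum_val (widen_ord Yq l))] == i.
  have := enum_valP (widen_ord Yq l); rewrite inE => /subsetP XN.
  by have := XN _ (enum_valP (cast_ord (esym Xp) k)); rewrite inE.
exists h.
  move=> [k|l] [k'|l'] //= [] /enum_val_inj E; congr (_ _).
    by apply: cast_ord_inj E.
  by apply: val_inj; have /= := congr1 val E.
move=> [k|l] [k'|l'] //= _; rewrite /class_adj /=; first exact: hc.
by rewrite setUC; exact: hc.
Qed.

Lemma sum_bin_colour_nbhd i p q : ~ contains_copy (colour_class c i) (K p q) ->
  \sum_v 'C(#|colour_nbhd i v|, p) <= 'C(a, p) * q.
Proof.
move=> nc; rewrite sum_bin_card -[a in 'C(a, _)]card_ord -card_draws.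
rewrite -sum_nat_const big_mkcond [X in _ <= X]big_mkcond /=.
apply: leq_sum => X _; rewrite inE; case: eqP => // Xp.
by rewrite leqNgt; apply/negP => /ltnW /(contains_copy_common_nbhd Xp).
Qed.

Lemma sum_colour_nbhd r v : (forall e, e \in edges (K a N) -> 1 <= c e <= r) ->
  \sum_(1 <= i < r.+1) #|colour_nbhd i v| = a.
Proof.
move=> cr; under eq_bigr do rewrite -sum1dep_card big_mkcond.
rewrite exchange_big /= -[RHS]card_ord -sum1_card; apply: eq_bigr => u _.
have /cr cuv : [set inl u; inr v] \in edges (K a N) by apply: mem_edges.
rewrite (bigD1_seq (c [set inl u; inr v])) ?iota_uniq ?mem_index_iota //=.
by rewrite eqxx big1 ?addn0 // => i; rewrite eq_sym => /negPf ->.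
Qed.
End CompleteBipartiteHost.

(** Summing [main] over [v] contradicts the hypothesis: colours 1 and 2 contribute at most
    ['C(a, s) * n] each, and colour [i >= 3] at most ['C(a, si i) * ti i]. *)
Lemma K_arrows r s si ti a n N : 2 <= r ->
  2 * 'C(a, s) * n + weight r s si a * (\sum_(3 <= i < r.+1) 'C(a, si i) * ti i)
    < N * weight r s si a ->
  arrows (K a N) r (forbidden s n si ti).
Proof.
move=> r2 big c cr; apply: contrapT => nc.
have {}nc i : 1 <= i <= r -> ~ contains_copy (colour_class c i) (forbidden s n si ti i).
  by move=> ir ic; apply: nc; exists i.
have nc1 := sum_bin_colour_nbhd (nc 1 (ltnW r2)).
have nc2 := sum_bin_colour_nbhd (nc 2 r2).
have nc3 i : 3 <= i <= r ->
    \sum_v 'C(#|colour_nbhd c i v|, si i) <= 'C(a, si i) * ti i.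
  move=> /andP[i3 ir]; apply: sum_bin_colour_nbhd.
  have := nc i; rewrite /forbidden (_ : (i <= 2) = false); last by lia.
  by apply; lia.
(* The last term pays for exceptional vertices: if some colour [i >= 3] occurs at least [si i] times
   at [v], the last sum is at least 1. *)
have main (v : 'I_N) : weight r s si a <=
    'C(#|colour_nbhd c 1 v|, s) + 'C(#|colour_nbhd c 2 v|, s) +
    weight r s si a * \sum_(3 <= i < r.+1) 'C(#|colour_nbhd c i v|, si i).
  have [/allP small|/allPn[i]] :=
    boolP (all (fun i => #|colour_nbhd c i v| < si i) (index_iota 3 r.+1)).
    apply: leq_trans (leq_addr _ _); apply: bin_balanced.
    rewrite leq_subLR -[X in X <= _](sum_colour_nbhd v cr).
    rewrite big_ltn ?ltnS ?(ltnW r2) // big_ltn ?ltnS // addnA addnC leq_add2r.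
    rewrite big_seq_cond [X in _ <= X]big_seq_cond.
    by apply: leq_sum => i; rewrite andbT => /small; lia.
  move=> ii; rewrite -leqNgt => si_le.
  apply: leq_trans (leq_addl _ _); rewrite leq_pmulr //.
  rewrite (bigD1_seq i) ?iota_uniq //=; apply: leq_trans (leq_addr _ _).
  by rewrite bin_gt0.
have := leq_sum (index_enum 'I_N) (fun v (_ : xpredT v) => main v).
rewrite sum_nat_const card_ord !big_split /= -big_distrr /= exchange_big /=.
have : \sum_(3 <= i < r.+1) \sum_(v < N) 'C(#|colour_nbhd c i v|, si i)
    <= \sum_(3 <= i < r.+1) 'C(a, si i) * ti i.
  rewrite big_seq_cond [X in _ <= X]big_seq_cond.
  by apply: leq_sum => i; rewrite andbT mem_index_iota => /nc3.
move=> XD /leq_trans/(_ (leq_add (leq_add nc1 nc2) (leq_mul (leqnn _) XD))).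
by rewrite leqNgt addnn -mul2n mulnA big.
Qed.

Lemma card_edges_K a N : #|edges (K a N)| <= a * N.
Proof.
pose e (p : 'I_a * 'I_N) : {set K a N} := [set inl p.1; inr p.2].
have -> : a * N = #|{: 'I_a * 'I_N}| by rewrite card_prod !card_ord.
apply: leq_trans (leq_imset_card e _); apply: subset_leq_card.
apply/subsetP => _ /imsetP[[[u|v] [u'|v']] //= _ ->]; apply/imsetP.
  by exists (u, v').
by exists (u', v); rewrite // /e setUC.
Qed.

(** One arrowing graph makes the set of edge counts nonempty, so the default of [xget] is not
    reached. *)
Lemma size_ramseyP (r : nat) (H : nat -> sgraph) G : arrows G r H ->
  is_minimum (fun e : nat =>
    exists2 G : sgraph, arrows G r H & e = #|edges G|) (size_ramsey r H).
Proof.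
move=> GH; pose P e := exists2 G' : sgraph, arrows G' r H & e = #|edges G'|.
suff : exists e, is_minimum P e by apply: xgetPex.
have Pex : exists e, `[< P e >] by exists #|edges G|; apply/asboolP; exists G.
case: (ex_minnP Pex) => e /asboolP Pe emin; exists e; split=> // x Px.
by rewrite leEnat; apply: emin; apply/asboolP.
Qed.

(** * Lower bound: equitable use of colour patterns *)

Lemma equitable_assignment (V I : finType) (B : {set V}) (Om : {set I}) :
  Om != set0 -> exists g : {ffun V -> I},
    (forall x, x \in B -> g x \in Om) /\
    (forall i, #|[set x in B | g x == i]| <= (#|B| %/ #|Om|).+1).
Proof.
case/set0Pn => i0 i0Om; have Om0 : 0 < #|Om| by apply/card_gt0P; exists i0.
(* Capacity 0 outside [Om] forces every value on [B] into [Om]. *)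
pose k i := if i \in Om then (#|B| %/ #|Om|).+1 else 0.
have [|g Hg] := @exists_capped_colouring V I i0 B k.
  by rewrite -big_mkcond sum_nat_const ltnW // mulnC ltn_ceil.
exists g; split=> [x xB|i]; last by apply: leq_trans (Hg i) _; rewrite /k; case: ifP.
apply: contraTT (Hg (g x)) => gx; rewrite /k (negPf gx) -ltnNge.
by apply/card_gt0P; exists x; rewrite inE xB eqxx.
Qed.

Section Patterns.
Variables (r s : nat) (si : nat -> nat) (V : finType) (T : {set V}).
Hypothesis r2 : 2 <= r.
Implicit Type phi : {ffun V -> 'I_r.+1}.
Implicit Type X : {set V}.

Let c1 : 'I_r.+1 := inord 1.
Let c2 : 'I_r.+1 := inord 2.

Definition colour_class_in phi (i : 'I_r.+1) := [set x in T | phi x == i].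

(* The value [ord0] stands for "not coloured". *)
Definition patterns : {set {ffun V -> 'I_r.+1}} := [set phi : {ffun V -> 'I_r.+1} |
  [&& [forall x, (phi x == ord0) == (x \notin T)],
      [forall i : 'I_r.+1, (3 <= i) ==> (#|colour_class_in phi i| < si i)] &
      'C(#|colour_class_in phi c1|, s) + 'C(#|colour_class_in phi c2|, s)
        <= weight r s si #|T|]].

Lemma val_c1 : c1 = 1 :> nat. Proof. by rewrite inordK //; lia. Qed.
Lemma val_c2 : c2 = 2 :> nat. Proof. by rewrite inordK //; lia. Qed.

Lemma patterns_neq0 : (forall i, 3 <= i <= r -> 0 < si i) -> patterns != set0.
Proof.
move=> si_gt0; set D := a' r si #|T|.
(* These capacities add up to at least [#|T|]; capacity 0 for the value 0 leaves no vertex of [T]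
   uncoloured. *)
pose k (i : nat) := match i with
  0 => 0 | 1 => D./2 | 2 => uphalf D | _ => si i - 1 end.
have [|phi Hphi] := @exists_capped_colouring V 'I_r.+1 ord0 T (fun i => k i).
  rewrite -(big_mkord xpredT) big_ltn // big_ltn ?ltnS ?(ltnW r2) // big_ltn ?ltnS //=.
  have -> : \sum_(3 <= i < r.+1) k i = \sum_(3 <= i < r.+1) (si i - 1).
    by apply: eq_big_nat => -[|[|[|i]]].
  rewrite add0n addnA (_ : D./2 + uphalf D = D); last by lia.
  by rewrite /D /a'; lia.
pose psi := [ffun x => if x \in T then phi x else ord0].
have psiE i : #|colour_class_in psi i| <= k i.
  apply: leq_trans (Hphi i); apply: subset_leq_card; apply/subsetP => x.
  by rewrite !inE ffunE => /andP[-> ].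
apply/set0Pn; exists psi; rewrite inE; apply/and3P; split.
- apply/forallP => x; rewrite ffunE; have [xT|] := boolP (x \in T) => //=.
  rewrite eqbF_neg; apply/negP => /eqP x0; have := Hphi ord0; rewrite /= leqn0 cards_eq0.
  by move/eqP/setP/(_ x); rewrite !inE xT x0 eqxx.
- apply/forallP => i; apply/implyP => i3; apply: leq_ltn_trans (psiE i) _.
  have : 0 < si i by apply: si_gt0; rewrite i3 -ltnS ltn_ord.
  by move: i3; rewrite /k; case: (nat_of_ord i) => [|[|[|m]]] //= _; lia.
- by apply: leq_add; apply: leq_bin2l; rewrite (leq_trans (psiE _)) ?val_c1 ?val_c2.
Qed.

Lemma card_patterns : #|patterns| <= r.+1 ^ #|T|.
Proof.
rewrite -[in X in _ <= X](card_ord r.+1) -(card_pffun_on ord0 (mem T) predT).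
apply: subset_leq_card; apply/subsetP => phi; rewrite inE => /and3P[/forallP phiT _ _].
apply/pffun_onP; split=> //; apply/subsetP => x; rewrite inE.
by rewrite (eqP (phiT x)) negbK.
Qed.

(** Being a pattern depends only on the support [T] and the class sizes, which a transposition
    within [T] preserves; this supplies the hypothesis of [card_mono_on]. *)
Lemma patterns_tperm x y phi : x \in T -> y \in T -> phi \in patterns ->
  [ffun z => phi (tperm x y z)] \in patterns.
Proof.
move=> xT yT; rewrite !inE => /and3P[/forallP phiT /forallP phi3 phi12].
have tT z : (tperm x y z \in T) = (z \in T).
  by case: tpermP => [->|->|] //; rewrite xT yT.
set psi := [ffun _ => _].
have E i : #|colour_class_in psi i| = #|colour_class_in phi i|.
  rewrite -(card_preimset (colour_class_in phi i) (@perm_inj _ (tperm x y))).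
  by apply: eq_card => z; rewrite !inE ffunE tT.
rewrite !E phi12 andbT; apply/andP; split; apply/forallP => z.
  by rewrite ffunE (eqP (phiT _)) tT.
by rewrite E.
Qed.

Lemma patterns_swap phi : phi \in patterns ->
  [ffun z => tperm c1 c2 (phi z)] \in patterns.
Proof.
rewrite !inE => /and3P[/forallP phiT /forallP phi3 phi12].
set psi := [ffun _ => _].
have E i : colour_class_in psi i = colour_class_in phi (tperm c1 c2 i).
  by apply/setP => z; rewrite !inE ffunE (canF_eq (tpermK _ _)).
rewrite !E tpermL tpermR addnC phi12 andbT; apply/andP; split; apply/forallP => z.
  rewrite ffunE (canF_eq (tpermK _ _)) tpermD ?phiT //.
    by apply/eqP => /(congr1 val) /=; rewrite val_c1.
  by apply/eqP => /(congr1 val) /=; rewrite val_c2.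
apply/implyP => z3; rewrite E tpermD; first exact: (implyP (phi3 z)).
  by apply/eqP => E'; move: z3; rewrite -E' val_c1.
by apply/eqP => E'; move: z3; rewrite -E' val_c2.
Qed.

Lemma leq_card_mono_on_swap X i :
  #|mono_on patterns X i| <= #|mono_on patterns X (tperm c1 c2 i)|.
Proof.
pose g phi := [ffun z => tperm c1 c2 (phi z)].
have gK : involutive g by move=> phi; apply/ffunP => z; rewrite !ffunE tpermK.
rewrite -(card_imset _ (inv_inj gK)); apply: subset_leq_card.
apply/subsetP => _ /imsetP[phi + ->].
rewrite /mono_on inE => /andP[pO /subsetP pX].
rewrite inE patterns_swap //=; apply/subsetP => z zX; rewrite inE ffunE.
by have := pX z zX; rewrite inE => /eqP ->.
Qed.

(** Swapping colours 1 and 2 shows that they are equally frequent on [X]. Adding [card_mono_on] for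
    both and using the weight bound of each pattern gives the fraction [1 / f(#|T|)]. *)
Lemma card_mono_on_patterns X i : X \subset T -> #|X| = s -> 0 < i <= 2 ->
  2 * (#|mono_on patterns X (inord i)| * 'C(#|T|, s))
    <= #|patterns| * weight r s si #|T|.
Proof.
move=> XT Xs i12.
have E : #|mono_on patterns X c2| = #|mono_on patterns X c1|.
  have := leq_card_mono_on_swap X c1; have := leq_card_mono_on_swap X c2.
  by rewrite tpermL tpermR => *; apply/eqP; rewrite eqn_leq; apply/andP.
have -> : #|mono_on patterns X (inord i)| = #|mono_on patterns X c1|.
  by have [->|->] : i = 1 \/ i = 2 by lia.
rewrite mul2n -addnn -{2}E -Xs !(card_mono_on patterns_tperm) // -big_split /=.
rewrite -sum_nat_const; apply: leq_sum => phi; rewrite inE => /and3P[_ _].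
by rewrite Xs.
Qed.
End Patterns.

(** * Colouring the edges across a vertex set *)

Lemma eq_set2 (V : finType) (x y z t : V) : [set x; y] = [set z; t] ->
  (x = z /\ y = t) \/ (x = t /\ y = z).
Proof.
move=> E; have := set21 x y; have := set22 x y; rewrite E !inE.
have := set21 z t; have := set22 z t; rewrite -E !inE.
by do 4![case/orP => /eqP ?]; subst; auto.
Qed.

Lemma edgesE (G : sgraph) (x y : G) : ([set x; y] \in edges G) = adj x y.
Proof.
apply/idP/idP => [/imsetP[[u v] /= uv /eq_set2[[-> ->]|[-> ->]]]|]; last exact: mem_edges.
  exact: uv.
by rewrite adj_sym; exact: uv.
Qed.

Section CrossColouring.
Variables (G : sgraph) (A : {set G}) (g : G -> G -> nat).

(** An edge is an unordered pair, so [pick] recovers its end in [A] and its end outside; the default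
    1 covers all other sets. *)
Definition cross_colour (e : {set G}) : nat :=
  if [pick p : G * G | [&& p.1 \in A, p.2 \notin A & e == [set p.1; p.2]]]
  is Some p then g p.2 p.1 else 1.

Lemma cross_colourE u v : u \in A -> v \notin A ->
  cross_colour [set u; v] = g v u.
Proof.
move=> uA vA; rewrite /cross_colour; case: pickP => [[x y] /=|/(_ (u, v))]; last first.
  by rewrite /= uA vA eqxx.
case/and3P=> xA yA /eqP/eq_set2[[-> ->] //|[Ex Ey]].
by rewrite -Ex uA in yA.
Qed.

Lemma cross_colour_neq1 x y : cross_colour [set x; y] != 1 ->
  (x \in A) = (y \notin A).
Proof.
rewrite /cross_colour; case: pickP => // -[u v] /= /and3P[uA vA /eqP E] _.
by have [[-> ->]|[-> ->]] := eq_set2 E; rewrite uA ?vA ?(negPf vA).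
Qed.
End CrossColouring.

(** * Degree and edge counts *)

Section Counting.
Variable G : sgraph.
Implicit Type A : {set G}.

Definition nbhd (x : G) : {set G} := [set y | adj x y].

Lemma sum_nbhd_le : \sum_x #|nbhd x| <= 2 * #|edges G|.
Proof.
apply: (@leq_trans (\sum_x \sum_(e in edges G) (x \in e))).
  apply: leq_sum => x _; rewrite -big_mkcondr -sum1_card /=.
  rewrite (eq_bigl (mem [set e in edges G | x \in e])); last by move=> e; rewrite !inE.
  rewrite !sum1_card -(card_in_imset (f := fun y => [set x; y])).
    apply: subset_leq_card; apply/subsetP => _ /imsetP[y + ->].
    by rewrite !inE eqxx edgesE => ->.
  move=> y z; rewrite !inE => xy xz /eq_set2[[]//|[E _]].
  by rewrite E adj_irrefl in xz.
rewrite exchange_big /= mulnC -sum_nat_const; apply: leq_sum => _ /imsetP[[x y] _ ->] /=.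
by rewrite -big_mkcond sum1_card cards2; case: eqP.
Qed.

Lemma card_high_degree n : n * #|[set x | n <= #|nbhd x|]| <= 2 * #|edges G|.
Proof.
apply: leq_trans sum_nbhd_le; rewrite mulnC -sum_nat_const big_mkcond.
by apply: leq_sum => x _; rewrite inE; case: ifP.
Qed.

Lemma sum_cross_nbhd_le A : \sum_(v in ~: A) #|nbhd v :&: A| <= #|edges G|.
Proof.
apply: (@leq_trans #|[set p : G * G | [&& p.1 \in ~: A, p.2 \in A & adj p.1 p.2]]|).
  rewrite -sum1dep_card.
  rewrite (eq_bigr (fun v => \sum_(u in nbhd v :&: A) 1)); last first.
    by move=> v _; rewrite sum1_card.
  rewrite pair_big_dep /= leq_eqVlt; apply/orP; left; apply/eqP; apply: eq_bigl => p.
  by rewrite !inE [adj _ _ && _]andbC.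
rewrite -(card_in_imset (f := fun p : G * G => [set p.1; p.2])).
  apply: subset_leq_card; apply/subsetP => _ /imsetP[p + ->].
  by rewrite inE edgesE => /and3P[].
move=> [x y] [z t]; rewrite !inE /= => /and3P[xA yA _] /and3P[zA tA _] /eq_set2.
by case=> [[-> ->] //|[E _]]; rewrite E tA in xA.
Qed.
End Counting.

(** * Lower bound on the number of edges of an arrowing graph *)

Section LowerBound.
Variables (r s : nat) (si ti : nat -> nat) (m : rat).
Hypotheses (r2 : 2 <= r) (s_gt0 : 0 < s).
Hypothesis si_gt0 : forall i, 3 <= i <= r -> 0 < si i.
Hypothesis st_le : forall i, 3 <= i <= r -> si i <= ti i.
Hypothesis m_ge0 : (0 <= m)%R.
(** This is [m <= d * f(d)] cleared of its denominator, so that it also makes sense when the weight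
    is 0. *)
Hypothesis m_le : forall d,
  (m * (weight r s si d)%:R <= (2 * 'C(d, s) * d)%:R)%R.

Lemma patterned_class_count (V : finType) (T B : {set V})
    (g : {ffun V -> {ffun V -> 'I_r.+1}}) (X : {set V}) i :
  (forall v, v \in B -> g v \in patterns r s si T) ->
  (forall phi, #|[set v in B | g v == phi]|
     <= (#|B| %/ #|patterns r s si T|).+1) ->
  #|X| = s -> 0 < i <= 2 ->
  (m * #|[set v in B | X \subset [set u | g v u == inord i]]|%:R
    <= (#|T| * #|B|)%:R + m * #|patterns r s si T|%:R)%R.
Proof.
move=> gB gcap Xs i12; set Om := patterns r s si T; set Y := [set _ in B | _].
have [->|[v0 v0Y]] := set_0Vmem Y.
  by rewrite cards0 mulr0 addr_ge0 ?ler0n ?mulr_ge0 ?ler0n.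
(* A pattern is [ord0] off [T], whereas the colour [i] is 1 or 2. *)
have XT : X \subset T.
  move: v0Y; rewrite inE => /andP[/gB]; rewrite inE => /andP[/forallP gT _] /subsetP Xi.
  apply/subsetP => u /Xi; rewrite inE => /eqP gu; have := gT u; rewrite gu.
  rewrite (_ : (inord i == ord0) = false); first by move/eqP/esym/negbFE.
  by apply/eqP => /(congr1 val) /=; rewrite inordK; lia.
set q := #|B| %/ #|Om|; set M := mono_on Om X (inord i).
(* Each pattern in [M] is used at most [q.+1] times; the rounding costs at most [#|Om|] in all. *)
have YM : #|Y| <= #|M| * q + #|Om|.
  apply: (@leq_trans (#|M| * q.+1)); last first.
    rewrite mulnS addnC leq_add2l; apply: subset_leq_card; apply/subsetP => phi.
    by rewrite inE => /andP[].
  rewrite -sum_nat_const -[#|Y|]sum1_card (partition_big g (mem M)) /=; last first.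
    by move=> v; rewrite inE => /andP[vB Xv]; rewrite inE gB.
  apply: leq_sum => phi _; rewrite sum1dep_card; apply: leq_trans (gcap phi).
  by apply: subset_leq_card; apply/subsetP => v; rewrite !inE => /andP[/andP[-> _] ->].
have Mq := card_mono_on_patterns si r2 XT Xs i12 : 2 * (#|M| * _) <= #|Om| * _.
have C0 : 0 < 'C(#|T|, s) by rewrite bin_gt0 -Xs subset_leq_card.
(* After multiplication by [2 * 'C(#|T|, s)], the frequency bound [Mq], then [#|Om| * q <= #|B|],
   then [m_le] apply in turn. *)
have key : (m * (#|M| * q)%:R <= (#|T| * #|B|)%:R)%R.
  rewrite -(ler_pM2l (_ : 0 < (2 * 'C(#|T|, s))%:R)%R) ?ltr0n ?muln_gt0 //.
  rewrite mulrCA -natrM -natrM.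
  apply: (@le_trans _ _ (m * (weight r s si #|T| * #|B|)%:R)%R).
    rewrite ler_wpM2l // ler_nat.
    apply: (@leq_trans (#|Om| * weight r s si #|T| * q)); last first.
      by rewrite mulnAC mulnC leq_mul2l [#|Om| * _]mulnC leq_divM orbT.
    apply: leq_trans (leq_mul Mq (leqnn q)).
    by rewrite leq_eqVlt; apply/orP; left; apply/eqP; ring.
  by rewrite !natrM mulrA [leRHS]mulrA ler_wpM2r ?ler0n // -!natrM m_le.
apply: (@le_trans _ _ (m * (#|M| * q + #|Om|)%:R)%R).
  by rewrite ler_wpM2l // ler_nat.
by rewrite natrD mulrDr lerD2r.
Qed.

(** The error depends on [#|A|] only: [#|A|] for vertices of the [n]-side inside [A], and at most
    [r.+1 ^ #|A|] patterns for each of the [2 ^ #|A|] traces. *)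
Lemma size_ramsey_lower_bound (G : sgraph) (n : nat) :
  let A := [set x : G | n <= #|nbhd x|] in
  arrows G r (forbidden s n si ti) ->
  (m * n%:R <= #|edges G|%:R + m * ((2 * r.+1) ^ #|A| + #|A|)%:R)%R.
Proof.
move=> A GH; have defA x : (x \in A) = (n <= #|nbhd x|) by rewrite inE.
clearbody A; pose trace v := nbhd v :&: A.
pose B T := [set v in ~: A | trace v == T].
have /fin_all_exists[g Hg] : forall T : {set G},
    exists g : {ffun G -> {ffun G -> 'I_r.+1}},
    (forall v, v \in B T -> g v \in patterns r s si T) /\
    (forall phi, #|[set v in B T | g v == phi]|
       <= (#|B T| %/ #|patterns r s si T|).+1).
  by move=> T; apply: equitable_assignment; apply: patterns_neq0.
pose h v : {ffun G -> 'I_r.+1} := g (trace v) v.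
have hP v : v \notin A -> h v \in patterns r s si (trace v).
  by move=> vA; apply: (Hg (trace v)).1; rewrite !inE vA eqxx.
have hr v u : v \notin A -> u \in A -> adj v u -> 0 < h v u <= r.
  move=> vA uA vu; rewrite leq_ord andbT lt0n -[0]/(val (@ord0 r)) (inj_eq val_inj).
  have := hP v vA; rewrite inE => /andP[/forallP/(_ u) /eqP -> _].
  by rewrite negbK !inE vu uA.
pose c := cross_colour A (fun v u => h v u : nat).
have cE u v : u \in A -> v \notin A -> c [set u; v] = h v u by apply: cross_colourE.
have cr e : e \in edges G -> 1 <= c e <= r.
  case/imsetP=> -[x y] xy ->; rewrite /= unfold_in /= in xy *.
  have [->|/cross_colour_neq1] := eqVneq (c [set x; y]) 1; first exact: ltnW.
  have [xA /esym yA|xA /esym/negbFE yA] := boolP (x \in A).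
    by rewrite cE // hr // adj_sym.
  by rewrite setUC cE // hr // xA.
have [i ir [f f_inj f_adj]] := GH c cr.
have [i2|i3] := leqP i 2; last first.
  exfalso; move: f f_inj f_adj; rewrite /forbidden leqNgt i3 /= => f f_inj f_adj.
  have i3r : 3 <= i <= r by lia.
  have small v : v \notin A -> #|[set u in trace v | c [set u; v] == i]| < si i.
    move=> vA; have := hP v vA; rewrite inE => /and3P[_ /forallP /(_ (inord i)) + _].
    rewrite inordK ?ltnS; last by lia.
    rewrite i3 /=; apply: leq_ltn_trans; apply: subset_leq_card; apply/subsetP => u.
    rewrite !inE => /andP[/andP[vu uA]]; rewrite cE // vu uA /= => /eqP E.
    by apply/eqP/val_inj; rewrite /= inordK ?ltnS //; lia.
  (* Edges of colour [i >= 3] cross between [A] and its complement, so every edge of the copy has an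
     end outside [A]. That end sees a whole side, of size at least [si i], in colour [i], against
     [small]. *)
  have many v p (e : 'I_p -> G) : injective e -> si i <= p -> v \notin A ->
      (forall k, adj v (e k) /\ c [set e k; v] = i) -> False.
    move=> e_inj sp vA He; have := small v vA; apply/negP; rewrite -leqNgt.
    apply: leq_trans sp _; rewrite -[p in p <= _]card_ord -(card_imset _ e_inj).
    apply: subset_leq_card; apply/subsetP => _ /imsetP[k _ ->].
    have [ve ce] := He k; rewrite !inE ve ce eqxx andbT /=.
    have : c [set e k; v] != 1 by rewrite ce; lia.
    by move/cross_colour_neq1 ->.
  have s0 := si_gt0 i3r; have t0 := leq_trans s0 (st_le i3r).
  have fE k l : adj (f (inl k)) (f (inr l)) /\ c [set f (inl k); f (inr l)] = i.
    by have /andP[? /eqP ?] := f_adj (inl k) (inr l) isT.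
  have finl : injective (fun k => f (inl k)) by move=> k l /f_inj [].
  have finr : injective (fun k => f (inr k)) by move=> k l /f_inj [].
  have [yA|yA] := boolP (f (inr (Ordinal t0)) \in A).
    apply: (many (f (inl (Ordinal s0))) _ _ finr (st_le i3r)).
      have : c [set f (inl (Ordinal s0)); f (inr (Ordinal t0))] != 1.
        by rewrite (fE _ _).2; lia.
      by move/cross_colour_neq1; rewrite yA => ->.
    by move=> l; rewrite setUC; apply: fE.
  apply: (many _ _ _ finl (leqnn _) yA) => k.
  by rewrite adj_sym; apply: fE.
move: f f_inj f_adj; rewrite /forbidden i2 /= => f f_inj f_adj.
have fE k l : adj (f (inl k)) (f (inr l)) /\ c [set f (inl k); f (inr l)] = i.
  by have /andP[? /eqP ?] := f_adj (inl k) (inr l) isT.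
have finl : injective (fun k => f (inl k)) by move=> k l /f_inj [].
have finr : injective (fun k => f (inr k)) by move=> k l /f_inj [].
pose X : {set G} := [set f (inl k) | k : 'I_s].
have Xs : #|X| = s by rewrite card_imset // card_ord.
(* Each vertex of the [s]-side is adjacent to the [n] images of the other side. *)
have XA : X \subset A.
  apply/subsetP => _ /imsetP[k _ ->]; rewrite defA -[n in n <= _]card_ord.
  rewrite -(card_imset _ finr); apply: subset_leq_card.
  by apply/subsetP => _ /imsetP[l _ ->]; rewrite inE; apply: (fE _ _).1.
pose Y T := [set v in B T | X \subset [set u | g T v u == inord i]].
(* The [n]-side lies in [A] or among the outside vertices whose pattern is constantly [i] on [X];
   the latter are sorted by trace. *)
have nY : n <= #|A| + \sum_(T in powerset A) #|Y T|.
  rewrite -[n in n <= _]card_ord -(card_imset _ finr).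
  pose Z : {set G} := [set v in ~: A | X \subset [set u | h v u == inord i]].
  apply: (@leq_trans #|A :|: Z|).
    apply: subset_leq_card; apply/subsetP => _ /imsetP[l _ ->]; rewrite !inE.
    have [//|lA /=] := boolP (_ \in A); apply/subsetP => _ /imsetP[k _ ->]; rewrite inE.
    apply/eqP/val_inj; rewrite /= inordK ?ltnS; last by lia.
    rewrite -(fE k l).2 cE //.
    by apply: (subsetP XA); apply/imsetP; exists k.
  apply: leq_trans (leq_card_setU _ _) _; rewrite leq_add2l.
  rewrite -[#|Z|]sum1_card (partition_big trace (mem (powerset A))) /=; last first.
    by move=> v _; rewrite inE subsetIr.
  apply: leq_sum => T _; rewrite sum1dep_card; apply: subset_leq_card.
  apply/subsetP => v; rewrite !inE /h => /andP[/andP[vA +] /eqP E].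
  by rewrite vA E eqxx.
have sumB : \sum_(T in powerset A) #|T| * #|B T| <= #|edges G|.
  apply: leq_trans (sum_cross_nbhd_le A).
  rewrite [X in _ <= X](partition_big trace (mem (powerset A))) /=; last first.
    by move=> v _; rewrite inE subsetIr.
  apply: leq_sum => T _; rewrite mulnC -sum_nat_const.
  rewrite (eq_bigl (fun v => (v \in ~: A) && (trace v == T))); last first.
    by move=> v; rewrite !inE.
  by apply: leq_sum => v /andP[_ /eqP <-].
have sumO : \sum_(T in powerset A) #|patterns r s si T| <= (2 * r.+1) ^ #|A|.
  rewrite expnMn -card_powerset -sum_nat_const; apply: leq_sum => T.
  rewrite inE => /subset_leq_card TA; apply: leq_trans (card_patterns _ _ _ _) _.
  by rewrite leq_exp2l // ltnS ltnW.
apply: (@le_trans _ _ (m * (#|A| + \sum_(T in powerset A) #|Y T|)%:R)%R).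
  by rewrite ler_wpM2l // ler_nat.
rewrite natrD mulrDr addrC [X in (_ <= _ + m * X)%R]natrD mulrDr addrA lerD2r.
apply: (@le_trans _ _ ((\sum_(T in powerset A) #|T| * #|B T|)%:R
    + m * (\sum_(T in powerset A) #|patterns r s si T|)%:R)%R); last first.
  by rewrite lerD ?ler_nat // ler_wpM2l // ler_nat.
rewrite !natr_sum !mulr_sumr -big_split /=; apply: ler_sum => T _.
have [gB gcap] := Hg T.
by apply: patterned_class_count => //; lia.
Qed.
End LowerBound.

(** * The threshold [sigma] and the minimiser *)

Section Sigma.
Variables (r s : nat) (si : nat -> nat).
Hypotheses (r2 : 2 <= r) (s_gt0 : 0 < s).
Hypothesis si_gt0 : forall i, 3 <= i <= r -> 0 < si i.

(** In this form [a > sigma] says [a' >= 2 * s - 1], that is, the larger half of [a'] is at least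
    [s]. *)
Lemma sigmaE : sigma r s si = 2 * s + \sum_(3 <= i < r.+1) (si i - 1) - 2.
Proof.
rewrite /sigma.
have -> : \sum_(3 <= i < r.+1) si i = \sum_(3 <= i < r.+1) (si i - 1) + (r - 2).
  rewrite -[r - 2]muln1 -[r - 2]/(r.+1 - 3) -sum_nat_const_nat -big_split /=.
  by apply: eq_big_nat => i /si_gt0; lia.
by lia.
Qed.

Lemma weight_gt0 a : sigma r s si < a -> 0 < weight r s si a.
Proof.
rewrite sigmaE /weight /a' => sa; rewrite addn_gt0 [X in _ || X]bin_gt0.
by apply/orP; right; lia.
Qed.

Lemma weight_eq0 a : a <= sigma r s si -> weight r s si a = 0.
Proof. by rewrite sigmaE /weight /a' => sa; rewrite !bin_small //; lia. Qed.

Lemma leq_weight a : weight r s si a <= 2 * 'C(a, s).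
Proof.
by rewrite mul2n -addnn /weight /a' leq_add // leq_bin2l //; lia.
Qed.

Lemma f_weightE a : f r s si a = (2 * 'C(a, s)%:R / (weight r s si a)%:R)%R.
Proof. by rewrite /f /weight natrD. Qed.

Lemma le_mul_f a : sigma r s si < a -> (a%:R <= a%:R * f r s si a :> rat)%R.
Proof.
move=> /weight_gt0 w0; rewrite ler_peMr ?ler0n // f_weightE ler_pdivlMr ?ltr0n //.
by rewrite mul1r -natrM ler_nat leq_weight.
Qed.
End Sigma.

(** Since [g b >= b], no [b] beyond [g a] can beat [a]; a finite search up to [M] suffices. *)
Lemma exists_minimizer (P : pred nat) (g : nat -> rat) : (exists a, P a) ->
  (forall a, P a -> (a%:R <= g a)%R) ->
  exists2 a, P a & forall b, P b -> (g a <= g b)%R.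
Proof.
move=> [a Pa] gP; pose M := a + Num.bound (g a).
have g0 b : P b -> (0 <= g b)%R by move=> /gP; apply: le_trans.
have aM : a < M.+1 by rewrite ltnS leq_addr.
case: (@arg_minP _ _ _ (Ordinal aM) (fun b : 'I_M.+1 => P b) (fun b => g b) Pa).
move=> b Pb bmin; exists (val b) => // c Pc.
have [cM|Mc] := leqP c M; first exact: (bmin (Ordinal (cM : c < M.+1))).
apply: le_trans (bmin (Ordinal aM) Pa) _; apply: le_trans (gP c Pc) => /=.
apply: le_trans (ltW (archi_boundP (g0 a Pa))) _; rewrite ler_nat.
by apply: leq_trans (ltnW Mc); rewrite leq_addl.
Qed.

(** * Size of the host and the asymptotic formula *)

Lemma size_ramsey_upper_bound r s si ti a n : 2 <= r -> 0 < weight r s si a ->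
  let D := \sum_(3 <= i < r.+1) 'C(a, si i) * ti i in
  exists2 G, arrows G r (forbidden s n si ti) &
    (#|edges G|%:R <= n%:R * (a%:R * f r s si a) + (a * D.+1)%:R :> rat)%R.
Proof.
(* [q] is the integer part of [n * f(a)]; of the further [D.+1] vertices, [D] absorb the colours
   from 3 on and one makes the inequality strict. *)
move=> r2 w0 D; pose q := 2 * 'C(a, s) * n %/ weight r s si a.
exists (K a (q + D.+1)).
  apply: K_arrows => //; rewrite -/D.
  have -> : (q + D.+1) * weight r s si a = q.+1 * weight r s si a + weight r s si a * D.
    by ring.
  by rewrite ltn_add2r ltn_ceil.
apply: (@le_trans _ _ (a * (q + D.+1))%:R%R); first by rewrite ler_nat card_edges_K.
rewrite mulnDr natrD lerD2r natrM mulrCA ler_wpM2l ?ler0n // f_weightE mulrA.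
rewrite ler_pdivlMr ?ltr0n // mulrC -!natrM ler_nat.
by rewrite [n * _]mulnC [weight _ _ _ _ * _]mulnC leq_divM.
Qed.

Theorem theorem10 (r s : nat) (si ti : nat -> nat)
  (hr : 2 <= r) (hs : 0 < s)
  (hsi : forall i, 3 <= i <= r -> 0 < si i)
  (hti : forall i, 3 <= i <= r -> 0 < ti i)
  (hst : forall i, 3 <= i <= r -> si i <= ti i) :
  exists2 m : rat,
    is_minimum (fun x : rat =>
      exists2 a : nat, sigma r s si < a & x = (a%:R * f r s si a)%R) m
    & exists (C : rat) (N : nat), forall n : nat, N <= n ->
        (`| (size_ramsey r (forbidden s n si ti))%:R - n%:R * m | <= C)%R.
Proof.
have [||a sa amin] := @exists_minimizer (fun a => sigma r s si < a)
  (fun a => (a%:R * f r s si a)%R).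
- by exists (sigma r s si).+1.
- by move=> a; apply: le_mul_f.
set m := (a%:R * f r s si a)%R in amin.
exists m; first by split=> [|_ [b sb ->]]; [exists a | apply: amin].
have w0 := weight_gt0 hr hs hsi sa.
have m0 : (0 <= m)%R by apply: le_trans (le_mul_f hr hs hsi sa); rewrite ler0n.
(* Up to [sigma] the weight vanishes; beyond it this is the minimality of [m]. *)
have m_le d : (m * (weight r s si d)%:R <= (2 * 'C(d, s) * d)%:R)%R.
  have [ds|sd] := leqP d (sigma r s si).
    by rewrite (weight_eq0 hr hs hsi ds) mulr0 ler0n.
  have wd := weight_gt0 hr hs hsi sd.
  rewrite -ler_pdivlMr ?ltr0n //; apply: le_trans (amin d sd) _.
  by rewrite f_weightE mulrA [(d%:R * _)%R]mulrC !natrM.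
pose D := \sum_(3 <= i < r.+1) 'C(a, si i) * ti i.
(* [c] will bound the number of vertices of degree at least [n], uniformly in [n]. *)
have [c mc] : exists c : nat, (2 * m < c%:R)%R.
  by exists (Num.bound (2 * m)%R); apply: archi_boundP; rewrite mulr_ge0.
pose P := ((a * D.+1)%:R : rat)%R; pose Q := (m * ((2 * r.+1) ^ c + c)%:R)%R.
have P0 : (0 <= P)%R by rewrite ler0n.
have Q0 : (0 <= Q)%R by rewrite mulr_ge0 ?ler0n.
exists (P + Q)%R, 1 => n n1.
have [G GH Gle] := size_ramsey_upper_bound ti n hr w0.
have [[G' G'H E] Emin] := size_ramseyP GH.
have := Emin _ (ex_intro2 _ _ G GH erefl); rewrite leEnat -(ler_nat rat) => EG.
have low := size_ramsey_lower_bound hr hs hsi hst m0 m_le G'H.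
have := card_high_degree G' n; rewrite -E in low *.
set e := size_ramsey _ _ in E EG low *; move: low; set A := finset _ => low An.
have hi : (e%:R <= n%:R * m + P)%R := le_trans EG Gle.
rewrite ler_norml lerBlDl lerBrDl; apply/andP; split; last first.
  by apply: le_trans hi _; rewrite lerD2l lerDl.
(* Only [e < n * m] needs work; then [n * #|A| <= 2 * e < 2 * m * n], and dividing by [n >= 1] gives
   [#|A| < c]. *)
have [me|em] := leP (n%:R * m)%R (e%:R)%R.
  by apply: le_trans me; rewrite gerDl oppr_le0 addr_ge0.
have Ac : #|A| <= c.
  rewrite -(ler_nat rat) ltW //; apply: le_lt_trans mc.
  rewrite -(ler_pM2l (_ : 0 < n%:R :> rat)%R) ?ltr0n // -natrM.
  apply: (@le_trans _ _ (2 * e)%:R%R); first by rewrite ler_nat.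
  by rewrite natrM mulrCA ler_wpM2l // ltW.
have QA : (m * ((2 * r.+1) ^ #|A| + #|A|)%:R <= Q)%R.
  by rewrite ler_wpM2l // ler_nat leq_add // leq_pexp2l // muln_gt0.
rewrite lerBlDr mulrC; apply: le_trans low _; rewrite lerD2l.
by apply: le_trans QA _; rewrite lerDr.
Qed.
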